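(* Let $D=D_1\cup\dots\cup D_p\subset(\mathbb{C}^2,0)$ be the germ of a reduced plane curve with irreducible components $D_1,\dots,D_p$. Let $\emptyset\neq J\subseteq\{1,\dots,p\}$ and $D'=\bigcup_{j\in J}D_j$. Then $\Omega^1(\log D')\subseteq\Omega^1(\log D)$. Renumbering the branches so that $J=\{1,\dots,q\}$ with $q\leqslant p$, one has $$\mathcal{R}_D\cap\big(Q(\mathcal{O}_{D_1})\oplus\dots\oplus Q(\mathcal{O}_{D_q})\oplus\{0\}^{p-q}\big)=\mathcal{R}_{D'},$$ where $\mathcal{R}_{D'}\subset Q(\mathcal{O}_{D'})=Q(\mathcal{O}_{D_1})\oplus\dots\oplus Q(\mathcal{O}_{D_q})$ is regarded inside $Q(\mathcal{O}_D)=\bigoplus_{i=1}^pQ(\mathcal{O}_{D_i})$ by extending with zeros.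
   Context: For a reduced plane curve germ $D\subset(\mathbb{C}^2,0)$ with reduced equation $f\in\mathbb{C}\{x,y\}$, $\mathcal{O}_D=\mathbb{C}\{x,y\}/(f)$ and $Q(\mathcal{O}_D)$ is its total ring of fractions. $\Omega^1(\log D)$ is the $\mathbb{C}\{x,y\}$-module of logarithmic $1$-forms: germs of meromorphic $1$-forms $\omega$ such that $f\omega$ and $f\,\mathrm{d}\omega$ are holomorphic. For every $\omega\in\Omega^1(\log D)$ there exist $g,\xi\in\mathbb{C}\{x,y\}$, with $g$ inducing a non zero divisor in $\mathcal{O}_D$, and a holomorphic $1$-form $\eta$, such that $g\omega=\xi\frac{\mathrm{d}f}{f}+\eta$; the logarithmic residue of $\omega$ is $\mathrm{res}(\omega)=\frac{\xi}{g}\big|_D\in Q(\mathcal{O}_D)$, which is well defined. The module of logarithmic residues is $\mathcal{R}_D=\{\mathrm{res}(\omega):\omega\in\Omega^1(\log D)\}\subseteq Q(\mathcal{O}_D)$. *)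

(* Defs.v *)
From HB Require Import structures.
From mathcomp Require Import all_boot all_order all_algebra.
From mathcomp Require Import generic_quotient ring_quotient fraction.
From mathcomp Require Import boolp classical_sets reals.
From mathcomp Require Import complex ring.

Set Implicit Arguments.
Unset Strict Implicit.
Unset Printing Implicit Defensive.

Import Order.TTheory GRing.Theory Num.Theory.
Local Open Scope ring_scope.
Local Open Scope quotient_scope.

Record fps (R : Type) := Fps { fcoef : nat -> R }.

Lemma fpsP (R : Type) (s t : fps R) : fcoef s =1 fcoef t -> s = t.
Proof. by case: s t => [s] [t] /= st; congr Fps; apply/funext. Qed.

HB.instance Definition _ (R : Type) := gen_eqMixin (fps R).
HB.instance Definition _ (R : Type) := gen_choiceMixin (fps R).

Section FpsRing.
Variable R : comNzRingType.
Implicit Types s t u : fps R.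

Definition fps0 : fps R := Fps (fun=> 0).
Definition fps1 : fps R := Fps (fun n => (n == 0)%:R).
Definition fps_opp s : fps R := Fps (fun n => - fcoef s n).
Definition fps_add s t : fps R := Fps (fun n => fcoef s n + fcoef t n).
Definition fps_mul s t : fps R :=
  Fps (fun n => \sum_(i < n.+1) fcoef s i * fcoef t (n - i)).

Let tr n s : {poly R} := \poly_(i < n.+1) fcoef s i.

Let trE n s i : (i <= n)%N -> (tr n s)`_i = fcoef s i.
Proof. by move=> lein; rewrite coef_poly ltnS lein. Qed.

Let mulE n s t i : (i <= n)%N -> fcoef (fps_mul s t) i = (tr n s * tr n t)`_i.
Proof.
move=> lein; rewrite coefM; apply: eq_bigr => j _.
rewrite !trE //; first exact: leq_trans (leq_subr _ _) lein.
exact: leq_trans (leq_ord j) lein.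
Qed.

Fact fps_addA : associative fps_add.
Proof. by move=> s t u; apply: fpsP => n /=; rewrite addrA. Qed.
Fact fps_addC : commutative fps_add.
Proof. by move=> s t; apply: fpsP => n /=; rewrite addrC. Qed.
Fact fps_add0 : left_id fps0 fps_add.
Proof. by move=> s; apply: fpsP => n /=; rewrite add0r. Qed.
Fact fps_addN : left_inverse fps0 fps_opp fps_add.
Proof. by move=> s; apply: fpsP => n /=; rewrite addNr. Qed.

HB.instance Definition _ :=
  GRing.isZmodule.Build (fps R) fps_addA fps_addC fps_add0 fps_addN.

Fact fps_mulC : commutative fps_mul.
Proof. by move=> s t; apply: fpsP => n; rewrite !(mulE _ _ (leqnn n)) mulrC. Qed.

Fact fps_mulA : associative fps_mul.
Proof.
move=> s t u; apply: fpsP => n.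
transitivity (tr n s * (tr n t * tr n u))`_n.
  rewrite coefM; apply: eq_bigr => j _; rewrite trE ?leq_ord //.
  by rewrite (@mulE n) ?leq_subr.
rewrite mulrA coefM; apply: eq_bigr => j _.
by rewrite trE ?leq_subr // (@mulE n) ?leq_ord.
Qed.

Fact fps_mul1 : left_id fps1 fps_mul.
Proof.
move=> s; apply: fpsP => n /=; rewrite big_ord_recl /= mul1r subn0 big1 ?addr0 //.
by move=> i _; rewrite mul0r.
Qed.

Fact fps_mulDl : left_distributive fps_mul fps_add.
Proof.
move=> s t u; apply: fpsP => n /=; rewrite -big_split /=.
by apply: eq_bigr => i _; rewrite mulrDl.
Qed.

Fact fps1_neq0 : fps1 != 0.
Proof.
apply/eqP => /(congr1 (fun s => fcoef s 0)) /= /eqP.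
by rewrite (oner_eq0 R).
Qed.

HB.instance Definition _ := GRing.Zmodule_isComNzRing.Build (fps R)
  fps_mulA fps_mulC fps_mul1 fps_mulDl fps1_neq0.

Lemma fcoef0 n : fcoef (0 : fps R) n = 0. Proof. by []. Qed.
Lemma fcoef1 n : fcoef (1 : fps R) n = (n == 0)%:R. Proof. by []. Qed.
Lemma fcoefN s n : fcoef (- s) n = - fcoef s n. Proof. by []. Qed.
Lemma fcoefD s t n : fcoef (s + t) n = fcoef s n + fcoef t n. Proof. by []. Qed.
Lemma fcoefM s t n :
  fcoef (s * t) n = \sum_(i < n.+1) fcoef s i * fcoef t (n - i).
Proof. by []. Qed.
Lemma fcoef_sum I (r : seq I) (P : pred I) (F : I -> fps R) n :
  fcoef (\sum_(i <- r | P i) F i) n = \sum_(i <- r | P i) fcoef (F i) n.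
Proof. by elim/big_rec2: _ => // i y x _ <-. Qed.

Lemma fcoefMn s m n : fcoef (s *+ m) n = fcoef s n *+ m.
Proof. by elim: m => // m IH; rewrite !mulrS fcoefD IH. Qed.

Lemma fps_integral :
  (forall a b : R, a * b = 0 -> a = 0 \/ b = 0) ->
  forall s t, s * t = 0 -> s = 0 \/ t = 0.
Proof.
move=> Rdom s t st0.
have lead u : u <> 0 ->
    exists2 k, fcoef u k <> 0 & forall i, (i < k)%N -> fcoef u i = 0.
  move=> u0; have exk : exists k, fcoef u k != 0.
    apply: contrapT => nk; apply: u0; apply: fpsP => n; rewrite fcoef0.
    by apply/eqP/negPn/negP => un; apply: nk; exists n.
  case: (ex_minnP exk) => k /eqP uk kmin; exists k => // i ik.
  by apply/eqP/negPn/negP => /kmin; rewrite leqNgt ik.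
apply: contrapT => /not_orP[/lead[a sa s0] /lead[b tb t0]].
have := congr1 (fun u => fcoef u (a + b)) st0; rewrite fcoefM fcoef0.
have lta : (a < (a + b).+1)%N by rewrite ltnS leq_addr.
rewrite (bigD1 (Ordinal lta)) //= addKn big1 => [|i ni].
  by rewrite addr0 => /Rdom[].
have [ia|ai|ia] := ltngtP i a; first by rewrite s0 ?mul0r.
  rewrite t0 ?mulr0 // ltn_subLR ?ltn_add2r //.
  by rewrite -ltnS ltn_ord.
by case/eqP: ni; apply: val_inj.
Qed.

Definition fps_deriv s : fps R := Fps (fun n => fcoef s n.+1 *+ n.+1).

Fact fps_derivB : zmod_morphism fps_deriv.
Proof. by move=> s t; apply: fpsP => n /=; rewrite mulrnDl mulNrn. Qed.

HB.instance Definition _ :=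
  GRing.isZmodMorphism.Build (fps R) (fps R) fps_deriv fps_derivB.

Lemma fps_derivM s t : fps_deriv (s * t) = fps_deriv s * t + s * fps_deriv t.
Proof.
have trD u n i : (i <= n)%N -> (tr n.+1 u)^`()`_i = (tr n (fps_deriv u))`_i.
  by move=> lein; rewrite coef_deriv !trE.
have trS u n i : (i <= n)%N -> (tr n.+1 u)`_i = (tr n u)`_i.
  by move=> lein; rewrite !trE // leqW.
apply: fpsP => n; transitivity ((tr n.+1 s * tr n.+1 t)^`()`_n).
  by rewrite coef_deriv -(@mulE n.+1).
rewrite derivM coefD fcoefD; congr (_ + _).
  rewrite (@mulE n (fps_deriv s)) // !coefM; apply: eq_bigr => i _.
  by rewrite trD ?leq_ord // trS ?leq_subr.
rewrite (@mulE n s) // !coefM; apply: eq_bigr => i _.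
by rewrite trD ?leq_subr // trS ?leq_ord.
Qed.

End FpsRing.

Section ConvergentSeries.
Variable F : numFieldType.
Implicit Types s t : fps (fps F).

(* Two-variable series are series in x whose coefficients are series in y;    *)
(* mcoef s i j is the coefficient of x^i y^j. *)
Definition mcoef s i j : F := fcoef (fcoef s i) j.

(* Convergence near the origin: for some r > 0 the series converges           *)
(* absolutely at (r, r), i.e. the partial sums of the absolute values are     *)
(* bounded. In a numFieldType, 0 < r forces r to be real. *)
Definition abs_psum s (r : F) n : F :=
  \sum_(i < n) \sum_(j < n) `|mcoef s i j| * r ^+ (i + j).

Definition convergent s : Prop :=
  exists r : F, 0 < r /\ exists M : F, forall n, abs_psum s r n <= M.

Definition cvg_series : {pred fps (fps F)} := fun s => `[< convergent s >].

Let abs_psum_mono s (r r' : F) n : 0 <= r -> r <= r' ->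
  abs_psum s r n <= abs_psum s r' n.
Proof.
move=> r0 rr'; apply: ler_sum => i _; apply: ler_sum => j _.
by rewrite ler_wpM2l // lerXn2r ?nnegrE // (le_trans r0).
Qed.

Let common s t : convergent s -> convergent t -> exists r : F, 0 < r /\
  exists M : F, forall n, abs_psum s r n <= M /\ abs_psum t r n <= M.
Proof.
move=> [r [r0 [M sM]]] [r' [r'0 [M' tM']]].
have M0 : 0 <= M by have := sM 0; rewrite /abs_psum big_ord0.
have M'0 : 0 <= M' by have := tM' 0; rewrite /abs_psum big_ord0.
have := real_comparable (gtr0_real r0) (gtr0_real r'0); case/orP => rr'.
- exists r; split => //; exists (M + M') => n; split.
    by rewrite (le_trans (sM n)) // lerDl.
  rewrite (le_trans (abs_psum_mono t n (ltW r0) rr')) //.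
  by rewrite (le_trans (tM' n)) // lerDr.
- exists r'; split => //; exists (M + M') => n; split.
    rewrite (le_trans (abs_psum_mono s n (ltW r'0) rr')) //.
    by rewrite (le_trans (sM n)) // lerDl.
  by rewrite (le_trans (tM' n)) // lerDr.
Qed.

Let cauchy_le (a b : nat -> F) n : (forall i, 0 <= a i) -> (forall i, 0 <= b i) ->
  \sum_(i < n) \sum_(k < i.+1) a k * b (i - k)%N
  <= (\sum_(i < n) a i) * (\sum_(i < n) b i).
Proof.
move=> a0 b0.
have -> : \sum_(i < n) \sum_(k < i.+1) a k * b (i - k)%N =
    \sum_(k < n) \sum_(i < n | (k <= i)%N) a k * b (i - k)%N.
  under eq_bigr => i _.
    rewrite (big_ord_widen n (fun k => a k * b (i - k)%N)) ?ltn_ord //.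
    over.
  by rewrite (exchange_big_dep xpredT).
rewrite mulr_suml; apply: ler_sum => k _.
rewrite -mulr_sumr ler_wpM2l //.
rewrite -(big_mkord (fun i => (k <= i)%N) (fun i => b (i - k)%N)).
rewrite -(big_mkord xpredT b) (big_cat_nat (n := k)) ?leq0n ?(ltnW (ltn_ord k)) //=.
rewrite big_nat_cond big1 ?add0r; last first.
  by move=> i /andP[/andP[_ ik]]; rewrite leqNgt ik.
rewrite -{1}[k : nat]add0n big_addn.
rewrite [leRHS](big_cat_nat (n := n - k)) ?leq_subr //=.
rewrite big_mkcond ler_wpDr ?sumr_ge0 //; apply: ler_sum => i _.
by rewrite leq_addl addnK.
Qed.

Let convergentD s t : convergent s -> convergent t -> convergent (s + t).
Proof.
move=> cs ct; have [r [r0 [M stM]]] := common cs ct.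
exists r; split => //; exists (M + M) => n; have [sM tM] := stM n.
apply: le_trans (lerD sM tM); rewrite -big_split /=.
apply: ler_sum => i _; rewrite -big_split /=; apply: ler_sum => j _.
by rewrite -mulrDl ler_wpM2r ?exprn_ge0 ?(ltW r0) // ler_normD.
Qed.

Let convergentN s : convergent s -> convergent (- s).
Proof.
move=> [r [r0 [M sM]]]; exists r; split => //; exists M => n.
rewrite (le_trans _ (sM n)) // ler_sum // => i _; apply: ler_sum => j _.
by rewrite /mcoef !fcoefN normrN.
Qed.

Let mcoef1 i j : mcoef 1 i j = ((i == 0) && (j == 0))%:R.
Proof. by rewrite /mcoef fcoef1; case: i. Qed.

Let convergent1 : convergent 1.
Proof.
exists 1; split => //; exists 1 => -[|n]; first by rewrite /abs_psum big_ord0.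
rewrite /abs_psum big_ord_recl big_ord_recl mcoef1 normr1 expr1n mulr1.
rewrite !big1 ?addr0 // => i _; last by rewrite mcoef1 normr0 mul0r.
by rewrite big1 // => j _; rewrite mcoef1 normr0 mul0r.
Qed.

Let convergentM s t : convergent s -> convergent t -> convergent (s * t).
Proof.
move=> cs ct; have [r [r0 [M stM]]] := common cs ct.
exists r; split => //; exists (M * M) => n; have [sM tM] := stM n.
have r_ge0 := ltW r0.
pose a i := \sum_(j < n) `|mcoef s i j| * r ^+ (i + j).
pose b i := \sum_(j < n) `|mcoef t i j| * r ^+ (i + j).
have ge0 (u : fps (fps F)) i j : 0 <= `|mcoef u i j| * r ^+ (i + j).
  by rewrite mulr_ge0 ?exprn_ge0.
have a0 i : 0 <= a i by apply: sumr_ge0.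
have b0 i : 0 <= b i by apply: sumr_ge0.
have sum0 (u : fps (fps F)) : 0 <= abs_psum u r n.
  by apply: sumr_ge0 => i _; apply: sumr_ge0.
apply: le_trans (ler_pM (sum0 s) (sum0 t) sM tM).
apply: le_trans (cauchy_le n a0 b0).
apply: ler_sum => i _.
pose c (k : 'I_i.+1) j := \sum_(l < j.+1) (`|mcoef s k l| * r ^+ (k + l)) *
       (`|mcoef t (i - k) (j - l)| * r ^+ ((i - k) + (j - l))).
apply: (@le_trans _ _ (\sum_(k < i.+1) \sum_(j < n) c k j)); last first.
  apply: ler_sum => k _.
  exact: (@cauchy_le (fun l => `|mcoef s k l| * r ^+ (k + l))
    (fun l => `|mcoef t (i - k) l| * r ^+ ((i - k) + l))).
rewrite exchange_big /=; apply: ler_sum => j _.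
rewrite /mcoef fcoefM fcoef_sum.
have -> : \sum_(k < i.+1) fcoef (fcoef s k * fcoef t (i - k)) j =
  \sum_(k < i.+1) \sum_(l < j.+1) mcoef s k l * mcoef t (i - k) (j - l) by [].
apply: le_trans (ler_wpM2r _ (ler_norm_sum _ _ _)) _; first exact: exprn_ge0.
rewrite mulr_suml; apply: ler_sum => k _.
apply: le_trans (ler_wpM2r _ (ler_norm_sum _ _ _)) _; first exact: exprn_ge0.
rewrite mulr_suml; apply: ler_sum => l _.
rewrite normrM mulrACA -exprD.
have -> : (k + l + (i - k + (j - l)) = i + j)%N.
  by rewrite addnACA !subnKC // -ltnS.
by [].
Qed.

Fact cvg_series_subring : subring_closed cvg_series.
Proof.
split; first exact/asboolP.
- move=> s t /asboolP cs /asboolP ct; apply/asboolP.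
  exact/convergentD/convergentN.
- by move=> s t /asboolP cs /asboolP ct; apply/asboolP/convergentM.
Qed.

HB.instance Definition _ :=
  GRing.isSubringClosed.Build (fps (fps F)) cvg_series cvg_series_subring.

Let expn_half i : (i.+1%:R * 2^-1 ^+ i <= 1 :> F).
Proof.
rewrite exprVn ler_pdivrMr ?exprn_gt0 // mul1r -natrX ler_nat.
exact: ltn_expl.
Qed.

Let half_pos (r : F) : 0 < r -> 0 < r * 2^-1.
Proof. by move=> r0; rewrite mulr_gt0 ?invr_gt0. Qed.

Let half_le1 n : (2^-1 ^+ n <= 1 :> F).
Proof. by rewrite exprn_ile1 ?invr_ge0 ?invf_le1 ?ler1n. Qed.

Let deriv_bound (z r : F) i k : 0 < r ->
  `|z *+ i.+1| * (r * 2^-1) ^+ (i + k) <= r^-1 * (`|z| * r ^+ (i + k).+1).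
Proof.
move=> r0; have r_ge0 := ltW r0.
have half : i.+1%:R * 2^-1 ^+ (i + k) <= 1 :> F.
  rewrite exprD mulrA mulr_ile1 //.
    by rewrite mulr_ge0 ?exprn_ge0 ?invr_ge0.
  by rewrite exprn_ge0 ?invr_ge0.
have -> : r^-1 * (`|z| * r ^+ (i + k).+1) = `|z| * r ^+ (i + k).
  by rewrite exprS mulrCA (mulKf (lt0r_neq0 r0)).
rewrite normrMn -[`|z| *+ _]mulr_natr -mulrA exprMn [_%:R * _]mulrCA mulrA.
by rewrite ler_wpM2l // -mulrA ler_piMr ?exprn_ge0.
Qed.

Fact convergent_dx s : s \in cvg_series -> fps_deriv s \in cvg_series.
Proof.
move=> /asboolP[r [r0 [M sM]]]; apply/asboolP; have r_ge0 := ltW r0.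
exists (r * 2^-1); split; first exact: half_pos.
exists (r^-1 * M) => n; apply: le_trans (ler_wpM2l _ (sM n.+1)); last first.
  by rewrite invr_ge0.
rewrite /abs_psum big_ord_recl mulrDr ler_wpDl //.
  rewrite mulr_ge0 ?invr_ge0 // sumr_ge0 // => j _.
  by rewrite mulr_ge0 ?exprn_ge0.
rewrite mulr_sumr ler_sum // => i _.
rewrite big_ord_recr /= mulrDr ler_wpDr //.
  by rewrite mulr_ge0 ?invr_ge0 // mulr_ge0 ?exprn_ge0.
rewrite mulr_sumr ler_sum // => j _.
have -> : mcoef (fps_deriv s) i j = mcoef s i.+1 j *+ i.+1.
  by rewrite /mcoef /= fcoefMn.
by rewrite /bump /= add1n addSn deriv_bound.
Qed.

Definition fps_deriv_inner s : fps (fps F) :=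
  Fps (fun i => fps_deriv (fcoef s i)).

Fact convergent_dy s : s \in cvg_series -> fps_deriv_inner s \in cvg_series.
Proof.
move=> /asboolP[r [r0 [M sM]]]; apply/asboolP; have r_ge0 := ltW r0.
exists (r * 2^-1); split; first exact: half_pos.
exists (r^-1 * M) => n; apply: le_trans (ler_wpM2l _ (sM n.+1)); last first.
  by rewrite invr_ge0.
rewrite /abs_psum big_ord_recr mulrDr ler_wpDr //.
  rewrite mulr_ge0 ?invr_ge0 // sumr_ge0 // => j _.
  by rewrite mulr_ge0 ?exprn_ge0.
rewrite mulr_sumr ler_sum // => i _.
rewrite big_ord_recl /= mulrDr ler_wpDl //.
  by rewrite mulr_ge0 ?invr_ge0 // mulr_ge0 ?exprn_ge0.
rewrite mulr_sumr ler_sum // => j _.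
by rewrite /bump /= add1n addnS [(i + j)%N]addnC deriv_bound.
Qed.

End ConvergentSeries.

(* germ F is F{x,y}; F will be the field of complex numbers. *)
Section Germs.
Variable F : numFieldType.

Record germ := Germ { series : fps (fps F); seriesP : series \in @cvg_series F }.

HB.instance Definition _ := [isSub for series].
HB.instance Definition _ := [Choice of germ by <:].
HB.instance Definition _ := [SubChoice_isSubComNzRing of germ by <:].

Implicit Types a b : germ.

Definition germ_unit : pred germ := fun a => `[< exists b, b * a = 1 >].
Definition germ_inv a : germ :=
  match pselect (exists b, b * a = 1) with
  | left ex => projT1 (cid ex)
  | right _ => a
  end.

Fact germ_mulV : {in germ_unit, left_inverse 1 germ_inv *%R}.
Proof.
by move=> a /asboolP ua; rewrite /germ_inv; case: pselect => // ex; case: cid.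
Qed.

Fact germ_unitPl a b : b * a = 1 -> germ_unit a.
Proof. by move=> ba; apply/asboolP; exists b. Qed.

Fact germ_inv_out : {in [predC germ_unit], germ_inv =1 id}.
Proof. by move=> a /asboolPn ua; rewrite /germ_inv; case: pselect. Qed.

HB.instance Definition _ := GRing.ComNzRing_hasMulInverse.Build germ
  germ_mulV germ_unitPl germ_inv_out.

Fact germ_integral a b : a * b = 0 -> (a == 0) || (b == 0).
Proof.
move=> /(congr1 val); rewrite rmorphM rmorph0 => ab0.
have domF (x y : F) : x * y = 0 -> x = 0 \/ y = 0.
  by move=> /eqP; rewrite mulf_eq0 => /orP[] /eqP; [left|right].
have [a0|b0] := fps_integral (fps_integral domF) ab0; apply/orP; [left|right];
  by apply/eqP/val_inj.
Qed.

HB.instance Definition _ := GRing.ComUnitRing_isIntegral.Build germ germ_integral.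

Lemma seriesB a b : series (a - b) = series a - series b.
Proof. exact: (rmorphB val). Qed.
Lemma seriesD a b : series (a + b) = series a + series b.
Proof. exact: (rmorphD val). Qed.
Lemma seriesM a b : series (a * b) = series a * series b.
Proof. exact: (rmorphM val). Qed.

Lemma series_inj : injective series. Proof. exact: val_inj. Qed.

Definition germ_dx a : germ := Germ (convergent_dx (seriesP a)).
Definition germ_dy a : germ := Germ (convergent_dy (seriesP a)).

Lemma series_dx a : series (germ_dx a) = fps_deriv (series a). Proof. by []. Qed.
Lemma series_dy a : series (germ_dy a) = fps_deriv_inner (series a).
Proof. by []. Qed.

Fact germ_dx_zmod : zmod_morphism germ_dx.
Proof. by move=> a b; apply: series_inj; rewrite seriesB !series_dx seriesB raddfB. Qed.

Fact germ_dy_zmod : zmod_morphism germ_dy.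
Proof.
move=> a b; apply: series_inj; rewrite seriesB !series_dy seriesB; apply: fpsP => i.
exact: (raddfB (@fps_deriv F)).
Qed.

HB.instance Definition _ := GRing.isZmodMorphism.Build germ germ germ_dx germ_dx_zmod.
HB.instance Definition _ := GRing.isZmodMorphism.Build germ germ germ_dy germ_dy_zmod.

Lemma germ_dxM a b : germ_dx (a * b) = germ_dx a * b + a * germ_dx b.
Proof. by apply: series_inj; rewrite seriesD !(series_dx, seriesM) fps_derivM. Qed.

Lemma germ_dyM a b : germ_dy (a * b) = germ_dy a * b + a * germ_dy b.
Proof.
apply: series_inj; rewrite seriesD !(series_dy, seriesM); apply: fpsP => i.
have -> u : fcoef (fps_deriv_inner u) i = fps_deriv (fcoef u i) by [].
rewrite fcoefD !fcoefM raddf_sum -big_split /=.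
by apply: eq_bigr => k _; rewrite fps_derivM.
Qed.

End Germs.

(* Extension of a derivation of an integral domain to its fraction field by   *)
(* the quotient rule; frac_der_frac shows that the choice of representatives  *)
(* is harmless. *)
Section FracDerivation.
Variables (A : idomainType) (D : {additive A -> A}).

Definition frac_der (m : {fraction A}) : {fraction A} :=
  let r : {ratio A} := repr m in
  FracField.tofrac (D \n_r * \d_r - \n_r * D \d_r) / FracField.tofrac (\d_r ^+ 2).

Lemma frac_der_frac :
  (forall a b, D (a * b) = D a * b + a * D b) ->
  forall n d, d != 0 ->
  frac_der (FracField.tofrac n / FracField.tofrac d) =
  FracField.tofrac (D n * d - n * D d) / FracField.tofrac (d ^+ 2).
Proof.
move=> DM n d d0; pose m := FracField.tofrac n / FracField.tofrac d.
rewrite -/m /frac_der; set r := repr m.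
have r0 : \d_r != 0 by exact: denom_ratioP.
have rE : n * \d_r = d * \n_r.
  have mE : m = \pi_({fraction A}) (Ratio n d).
    rewrite /m; unlock FracField.tofrac; rewrite -[_^-1]FracField.pi_inv.
    rewrite -[LHS]FracField.pi_mul /FracField.mulf /FracField.invf.
    by rewrite !numden_Ratio ?oner_eq0 ?mul1r ?mulr1.
  have : m = \pi_({fraction A}) r by rewrite reprK.
  by rewrite mE => /eqP; rewrite FracField.equivf_def !numden_Ratio // => /eqP.
have := congr1 D rE; rewrite !DM => DE.
apply/eqP; rewrite eqr_div ?tofrac_eq0 ?expf_neq0 // -!tofracM tofrac_eq.
rewrite -subr_eq0; move: rE DE => /eqP + /eqP; rewrite -subr_eq0 => /eqP G.
rewrite -subr_eq0 => /eqP E; apply/eqP.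
transitivity (- (d * \d_r * (D n * \d_r + n * D \d_r - (D d * \n_r + d * D \n_r)))
  + (d * D \d_r + \d_r * D d) * (n * \d_r - d * \n_r)); first by ring.
by rewrite E G !mulr0 oppr0 addr0.
Qed.

End FracDerivation.

(* The total ring of fractions of a commutative ring: fractions whose         *)
(* denominators are non zero divisors. *)
Section TotalFractions.
Variable B : comNzRingType.
Implicit Types a b c : B.

Definition nzd : pred B := fun b => `[< forall c, b * c = 0 -> c = 0 >].

Lemma nzdP b : reflect (forall c, b * c = 0 -> c = 0) (nzd b).
Proof. exact: asboolP. Qed.

Lemma nzd1 : nzd 1.
Proof. by apply/nzdP => c; rewrite mul1r. Qed.

Lemma nzdM a b : nzd a -> nzd b -> nzd (a * b).
Proof. by move=> /nzdP na /nzdP nb; apply/nzdP => c; rewrite -mulrA => /na/nb. Qed.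

Lemma nzdI a b c : nzd a -> a * b = a * c -> b = c.
Proof.
move=> /nzdP na /eqP; rewrite -subr_eq0 -mulrBr => /eqP/na/eqP.
by rewrite subr_eq0 => /eqP.
Qed.

Record tratio := TRatio { tnum : B; tden : B; tden_nzd : nzd tden }.

HB.instance Definition _ := gen_eqMixin tratio.
HB.instance Definition _ := gen_choiceMixin tratio.

Implicit Types x y z : tratio.

Definition equivt x y := tnum x * tden y == tden x * tnum y.

Fact equivt_refl : reflexive equivt.
Proof. by move=> x; rewrite /equivt mulrC. Qed.

Fact equivt_sym : symmetric equivt.
Proof. by move=> x y; rewrite /equivt eq_sym; congr (_ == _); rewrite mulrC. Qed.

Fact equivt_trans : transitive equivt.
Proof.
move=> y x z /eqP xy /eqP yz; apply/eqP.
apply: (@nzdI (tden y)); first exact: tden_nzd.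
by rewrite mulrA [tden y * _]mulrC xy -mulrA yz mulrCA.
Qed.

Canonical equivt_equiv := EquivRel equivt equivt_refl equivt_sym equivt_trans.

Definition tfrac := {eq_quot equivt}.
HB.instance Definition _ : EqQuotient _ equivt tfrac := EqQuotient.on tfrac.
HB.instance Definition _ := Choice.on tfrac.

Definition tfrac_of a b (hb : nzd b) : tfrac := \pi_tfrac (TRatio a hb).

Lemma tfrac_eq a b c d (hb : nzd b) (hd : nzd d) :
  tfrac_of a hb = tfrac_of c hd <-> a * d = b * c.
Proof.
by split=> [/eqP|H]; [|apply/eqP]; rewrite /tfrac_of eqmodE /= /equivt /= => *; apply/eqP.
Qed.

Lemma tfracW (P : tfrac -> Prop) :
  (forall a b (hb : nzd b), P (tfrac_of a hb)) -> forall u, P u.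
Proof. by move=> H; elim/quotW => -[a b hb]; apply: H. Qed.

Definition taddt x y : tratio :=
  TRatio (tnum x * tden y + tnum y * tden x) (nzdM (tden_nzd x) (tden_nzd y)).
Definition toppt x : tratio := TRatio (- tnum x) (tden_nzd x).
Definition tmult x y : tratio :=
  TRatio (tnum x * tnum y) (nzdM (tden_nzd x) (tden_nzd y)).

Definition tadd (u v : tfrac) : tfrac := \pi_tfrac (taddt (repr u) (repr v)).
Definition topp (u : tfrac) : tfrac := \pi_tfrac (toppt (repr u)).
Definition tmul (u v : tfrac) : tfrac := \pi_tfrac (tmult (repr u) (repr v)).
Definition tzero : tfrac := tfrac_of 0 nzd1.
Definition tone : tfrac := tfrac_of 1 nzd1.

Let reprE a b (hb : nzd b) : a * tden (repr (tfrac_of a hb)) =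
   b * tnum (repr (tfrac_of a hb)).
Proof.
apply/(tfrac_eq a _ hb (tden_nzd _)); rewrite /tfrac_of.
by rewrite -[LHS]reprK; case: (repr _).
Qed.

Lemma tadd_frac a b c d (hb : nzd b) (hd : nzd d) :
  tadd (tfrac_of a hb) (tfrac_of c hd) =
  tfrac_of (a * d + c * b) (nzdM hb hd).
Proof.
apply/esym/tfrac_eq => /=; have := reprE a hb; have := reprE c hd.
set u := repr _; set v := repr _ => cE aE.
rewrite mulrDl mulrDr; congr (_ + _).
  by rewrite mulrACA aE mulrACA.
by rewrite [tden v * _]mulrC mulrACA cE [b * d]mulrC mulrACA.
Qed.

Lemma topp_frac a b (hb : nzd b) : topp (tfrac_of a hb) = tfrac_of (- a) hb.
Proof. by apply/esym/tfrac_eq; rewrite /= mulNr mulrN reprE. Qed.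

Lemma tmul_frac a b c d (hb : nzd b) (hd : nzd d) :
  tmul (tfrac_of a hb) (tfrac_of c hd) = tfrac_of (a * c) (nzdM hb hd).
Proof. by apply/esym/tfrac_eq; rewrite /= mulrACA !reprE mulrACA. Qed.

Fact taddA : associative tadd.
Proof.
elim/tfracW=> a b hb; elim/tfracW=> c d hd; elim/tfracW=> e g hg.
by rewrite !tadd_frac; apply/tfrac_eq; ring.
Qed.

Fact taddC : commutative tadd.
Proof.
elim/tfracW=> a b hb; elim/tfracW=> c d hd; rewrite !tadd_frac; apply/tfrac_eq.
by rewrite addrC mulrC [b * d]mulrC.
Qed.

Fact tadd0 : left_id tzero tadd.
Proof.
elim/tfracW=> a b hb; rewrite tadd_frac; apply/tfrac_eq.
by rewrite mul0r add0r mulr1 mul1r mulrC.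
Qed.

Fact taddN : left_inverse tzero topp tadd.
Proof.
elim/tfracW=> a b hb; rewrite topp_frac tadd_frac; apply/tfrac_eq.
by rewrite mulNr addNr mul0r mulr0.
Qed.

HB.instance Definition _ := GRing.isZmodule.Build tfrac taddA taddC tadd0 taddN.

Fact tmulA : associative tmul.
Proof.
elim/tfracW=> a b hb; elim/tfracW=> c d hd; elim/tfracW=> e g hg.
by rewrite !tmul_frac; apply/tfrac_eq; rewrite mulrC !mulrA.
Qed.

Fact tmulC : commutative tmul.
Proof.
elim/tfracW=> a b hb; elim/tfracW=> c d hd; rewrite !tmul_frac; apply/tfrac_eq.
by rewrite mulrC [a * c]mulrC [b * d]mulrC.
Qed.

Fact tmul1 : left_id tone tmul.
Proof.
elim/tfracW=> a b hb; rewrite tmul_frac; apply/tfrac_eq.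
by rewrite !mul1r mulrC.
Qed.

Fact tmulDl : left_distributive tmul tadd.
Proof.
elim/tfracW=> a b hb; elim/tfracW=> c d hd; elim/tfracW=> e g hg.
by rewrite !(tadd_frac, tmul_frac); apply/tfrac_eq; ring.
Qed.

Fact tone_neq0 : tone != 0.
Proof.
by apply/eqP => /tfrac_eq; rewrite mulr1 mulr0 => /eqP; rewrite oner_eq0.
Qed.

HB.instance Definition _ :=
  GRing.Zmodule_isComNzRing.Build tfrac tmulA tmulC tmul1 tmulDl tone_neq0.

End TotalFractions.

(* The map induced on total rings of fractions by a map of rings preserving   *)
(* non zero divisors (junk value 0 when the image of the denominator is a     *)
(* zero divisor). *)
Definition tfrac_map (B B' : comNzRingType) (phi : B -> B') (u : tfrac B) :
    tfrac B' :=
  let r := repr u in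
  match pselect (nzd (phi (tden r))) with
  | left h => tfrac_of (phi (tnum r)) h
  | right _ => 0
  end.

Section Curves.
Variable F : numFieldType.
Local Notation A := (germ F).
Local Notation K := {fraction A}.
Local Notation "a %:F" := (@FracField.tofrac A a).

Definition gdvd (a b : A) : Prop := exists c, b = c * a.
Definition associated (a b : A) : Prop := exists2 u, u \is a GRing.unit & b = u * a.
Definition irreducible_germ (a : A) : Prop :=
  [/\ a != 0, a \isn't a GRing.unit &
      forall b c, a = b * c -> b \is a GRing.unit \/ c \is a GRing.unit].

(* A reduced plane curve germ, given by an equation f which is neither zero   *)
(* nor invertible and such that C{x,y}/(f) has no nilpotent element. *)
Record curve := Curve {
  ceq : A;
  ceq_neq0 : ceq != 0;
  ceq_nonunit : ceq \isn't a GRing.unit;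
  ceq_reduced : forall h n, gdvd ceq (h ^+ n) -> gdvd ceq h }.

Implicit Types D E : curve.

Definition in_ideal D : pred A := fun h => `[< gdvd (ceq D) h >].

Fact ideal_closed D : idealr_closed (in_ideal D).
Proof.
split.
- by apply/asboolP; exists 0; rewrite mul0r.
- apply/asboolPn => -[c c1]; have := ceq_nonunit D.
  by move/negP; apply; apply/unitrP; exists c; rewrite [ceq D * c]mulrC -c1.
- move=> a u v /asboolP[c ->] /asboolP[d ->]; apply/asboolP.
  by exists (a * c + d); rewrite mulrDl mulrA.
Qed.

HB.instance Definition _ D := isIdealr.Build A (in_ideal D) (ideal_closed D).
Definition ideal D : idealr A := in_ideal D.

Definition local_ring D : comNzRingType := {ideal_quot (ideal D)}.
Definition cls D (a : A) : local_ring D := \pi_({ideal_quot (ideal D)}) a.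

Definition frac_ring D : comNzRingType := tfrac (local_ring D).

(* The meromorphic 1-form a dx + b dy is encoded by the pair (a, b), where    *)
(* K = Frac C{x,y} is the field of germs of meromorphic functions. *)
Definition merform := (K^o * K^o)%type.
Implicit Types w : merform.

Definition holomorphic (m : K) : Prop := exists a : A, m = a%:F.
Definition holomorphic_form w : Prop := holomorphic w.1 /\ holomorphic w.2.
Definition dfun (a : A) : merform := ((germ_dx a)%:F, (germ_dy a)%:F).

(* The coefficient of dx /\ dy in dw. *)
Definition ext_d w : K := frac_der (@germ_dx F) w.2 - frac_der (@germ_dy F) w.1.

Definition log_forms D : set merform :=
  [set w : merform | holomorphic_form ((ceq D)%:F *: w) /\
                     holomorphic ((ceq D)%:F * ext_d w)].

(* rho is the residue xi / g of w, for some relation g w = xi df/f + eta. *)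
Definition is_residue D w (rho : frac_ring D) : Prop :=
  exists (g xi : A) (hg : nzd (cls D g)) (eta : merform),
    [/\ holomorphic_form eta,
        g%:F *: w = xi%:F *: ((ceq D)%:F^-1 *: dfun (ceq D)) + eta
      & rho = tfrac_of (cls D xi) hg].

Definition residues D : set (frac_ring D) :=
  [set rho | exists2 w, log_forms D w & is_residue w rho].

Definition restr_local D E (a : local_ring D) : local_ring E := cls E (repr a).
Definition restr D E : frac_ring D -> frac_ring E := tfrac_map (@restr_local D E).

(* D is the union of the D_i, i \in P, pairwise without common component: the *)
(* product of the equations is an equation of D (common components are        *)
(* excluded because D is reduced). *)
Definition is_union (I : finType) (P : {pred I}) (Di : I -> curve) D : Prop :=
  associated (\prod_(i in P) ceq (Di i)) (ceq D).

Definition irreducible_curve D : Prop := irreducible_germ (ceq D).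

(* The identification of Q(O_D) with the direct sum of the Q(O_{D_i}), and    *)
(* the embedding of Q(O_{D'}), D' being the union of the D_j, j \in J, in this *)
(* direct sum by extension by zero. By restr_inj and restr_surj below,        *)
(* branch_parts is bijective when D is the union of the D_i. *)
Definition branch_parts p (Di : 'I_p -> curve) D (rho : frac_ring D) :
    forall i, frac_ring (Di i) :=
  fun i => restr (Di i) rho.

Definition extend0 p (Di : 'I_p -> curve) (J : {set 'I_p}) D'
    (rho : frac_ring D') : forall i, frac_ring (Di i) :=
  fun i => if i \in J then restr (Di i) rho else 0.

Implicit Types a b c : A.

Lemma gdvd_mull a b c : gdvd a b -> gdvd a (c * b).
Proof. by move=> [d ->]; exists (c * d); rewrite mulrA. Qed.

Lemma gdvd_mulr a b c : gdvd a b -> gdvd a (b * c).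
Proof. by rewrite mulrC; apply: gdvd_mull. Qed.

Lemma gdvdB a b c : gdvd a b -> gdvd a c -> gdvd a (b - c).
Proof. by move=> [d ->] [e ->]; exists (d - e); rewrite mulrBl. Qed.

Lemma gdvd_sum a (I : Type) (r : seq I) (P : pred I) (G : I -> A) :
  (forall i, P i -> gdvd a (G i)) -> gdvd a (\sum_(i <- r | P i) G i).
Proof.
move=> H; elim/big_rec: _ => [|i x Pi [c ->]]; first by exists 0; rewrite mul0r.
by have [d ->] := H i Pi; exists (d + c); rewrite mulrDl.
Qed.

Lemma cls_eq D a b : cls D a = cls D b <-> gdvd (ceq D) (a - b).
Proof.
have E : (cls D a == cls D b) = in_ideal D (a - b) by rewrite /cls -Quotient.idealrBE.
by split=> [/eqP|H]; [|apply/eqP]; move: E => -> //; [move/asboolP|apply/asboolP].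
Qed.

Lemma clsM D a b : cls D (a * b) = cls D a * cls D b.
Proof. exact: (rmorphM (\pi_({ideal_quot (ideal D)}))). Qed.

Lemma cls0 D : cls D 0 = 0.
Proof. exact: (rmorph0 (\pi_({ideal_quot (ideal D)}))). Qed.

Lemma cls_repr D (u : local_ring D) : cls D (repr u) = u.
Proof. exact: reprK. Qed.

Lemma nzd_cls D b :
  nzd (cls D b) <-> forall u, gdvd (ceq D) (b * u) -> gdvd (ceq D) u.
Proof.
split=> [/nzdP H u bu|H].
  have := H (cls D u); rewrite -clsM -(cls0 D) => /(_ _)/cls_eq.
  by rewrite subr0; apply; apply/cls_eq; rewrite subr0.
apply/nzdP => u; rewrite -(cls_repr u) -clsM -(cls0 D) => /cls_eq.
by rewrite subr0 => /H bu; apply/cls_eq; rewrite subr0.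
Qed.

Lemma tfrac_cls_eq D a b c d (hb : nzd (cls D b)) (hd : nzd (cls D d)) :
  tfrac_of (cls D a) hb = tfrac_of (cls D c) hd <->
  gdvd (ceq D) (a * d - b * c).
Proof. by rewrite tfrac_eq -!clsM cls_eq. Qed.

Lemma frac_ringW D (P : frac_ring D -> Prop) :
  (forall a b (hb : nzd (cls D b)), P (tfrac_of (cls D a) hb)) -> forall u, P u.
Proof.
move=> H; elim/tfracW => a b; rewrite -(cls_repr a) -(cls_repr b); exact: H.
Qed.

Lemma nzd_restr D E b : gdvd (ceq E) (ceq D) -> nzd (cls D b) -> nzd (cls E b).
Proof.
move=> [h Dh] /nzd_cls nb; apply/nzd_cls => u [v buv].
have [|w] := nb (h * u); first by exists v; rewrite mulrCA buv Dh mulrCA.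
have h0 : h != 0 by apply: contraTneq (ceq_neq0 D) => h0; rewrite Dh h0 mul0r eqxx.
by rewrite Dh mulrCA => /(mulfI h0) ->; exists w.
Qed.

(* For E contained in D, restr is the natural map of total rings of fractions. *)
Lemma restr_frac D E a b (hb : nzd (cls D b)) (hb' : nzd (cls E b)) :
  gdvd (ceq E) (ceq D) ->
  restr E (tfrac_of (cls D a) hb) = tfrac_of (cls E a) hb'.
Proof.
move=> ED; rewrite /restr /tfrac_map; set u := tfrac_of _ _.
have : u = tfrac_of (tnum (repr u)) (tden_nzd (repr u)).
  by rewrite -[LHS]reprK; case: (repr u).
move=> /tfrac_eq; have := tden_nzd (repr u).
move: (tden _) (tnum _) => d c.
rewrite -{1 2}(cls_repr d) -{1}(cls_repr c) -!clsM => hd /cls_eq [w W].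
rewrite /restr_local; case: pselect => [h|nh]; last by case: nh; apply: nzd_restr hd.
have [c1 E1] := ED; apply/tfrac_cls_eq; exists (- (w * c1)).
by rewrite mulNr -mulrA -E1 -W opprB [repr c * b]mulrC [repr d * a]mulrC.
Qed.

Section Union.
Variables (I : finType) (P : {pred I}) (Di : I -> curve) (D : curve).
Hypothesis DP : is_union P Di D.

Let ceq_in i : i \in P -> gdvd (ceq (Di i)) (ceq D).
Proof.
move=> Pi; case: DP => u _ ->; rewrite (bigD1 i) //=; apply: gdvd_mull.
by apply: gdvd_mulr; exists 1; rewrite mul1r.
Qed.

Let ceq_cap a : (forall i, i \in P -> gdvd (ceq (Di i)) a) -> gdvd (ceq D) a.
Proof.
move=> aP; apply: (@ceq_reduced D _ #|P|); case: DP => u uU ->.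
have /choice[c cP] : forall i, exists c, i \in P -> a = c * ceq (Di i).
  move=> i; have [/aP[c ac]|nP] := boolP (i \in P); first by exists c.
  by exists 0 => iP; case/negP: nP.
exists (u^-1 * \prod_(i in P) c i); rewrite mulrACA mulVr // mul1r -big_split /=.
by rewrite -prodr_const; apply: eq_bigr => i /cP.
Qed.

Let cofac i := \prod_(j in P | j != i) ceq (Di j).

Let cofacE i : i \in P -> associated (cofac i * ceq (Di i)) (ceq D).
Proof. by move=> Pi; case: DP => u uU ->; exists u => //; rewrite (bigD1 i) //= [cofac _ * _]mulrC. Qed.

Let cofac_div i j : j \in P -> j != i -> gdvd (ceq (Di j)) (cofac i).
Proof.
move=> Pj ji; rewrite /cofac (bigD1 j) ?Pj //=.
by apply: gdvd_mulr; exists 1; rewrite mul1r.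
Qed.

Let cofac_nzd i u : i \in P -> gdvd (ceq (Di i)) (cofac i * u) ->
  gdvd (ceq (Di i)) u.
Proof.
move=> Pi [w W]; case: (cofacE Pi) => e eU De.
have [|c cE] := @ceq_reduced D (cofac i * u) 2.
  exists (w * u * e^-1); rewrite De expr2 {1}W; have := mulVr eU; move: (e^-1) => v ve1.
  transitivity (w * u * cofac i * ceq (Di i) * (v * e)); last by ring.
  by rewrite ve1; ring.
have c0 : cofac i != 0.
  by apply: contraTneq (ceq_neq0 D) => c0; rewrite De c0 mul0r mulr0 eqxx.
exists (c * e); apply: (mulfI c0); rewrite cE De; ring.
Qed.

(* Q(O_D) is the direct sum of the Q(O_{D_i}), i \in P. *)
Lemma restr_inj rho rho' :
  (forall i, i \in P -> restr (Di i) rho = restr (Di i) rho') ->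
  rho = rho' :> frac_ring D.
Proof.
elim/frac_ringW: rho => a b hb; elim/frac_ringW: rho' => c d hd H.
apply/tfrac_cls_eq/ceq_cap => i Pi; have iD := ceq_in Pi; move: (H i Pi).
by rewrite (restr_frac _ hb (nzd_restr iD hb) iD)
  (restr_frac _ hd (nzd_restr iD hd) iD) => /tfrac_cls_eq.
Qed.

Lemma restr_surj (z : forall i, frac_ring (Di i)) :
  exists rho : frac_ring D, forall i, i \in P -> restr (Di i) rho = z i.
Proof.
have /choice[ab abP] : forall i, exists ab : A * A,
    exists hb : nzd (cls (Di i) ab.2), z i = tfrac_of (cls (Di i) ab.1) hb.
  by move=> i; elim/frac_ringW: (z i) => a b hb; exists (a, b), hb.
pose a := \sum_(i in P) (ab i).1 * cofac i.
pose b := \sum_(i in P) (ab i).2 * cofac i.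
have hb : nzd (cls D b).
  apply/nzd_cls => u bu; apply: ceq_cap => i Pi; apply: cofac_nzd => //.
  have [/nzd_cls hbi _] := abP i; apply: hbi.
  have -> : (ab i).2 * (cofac i * u) =
      b * u - (\sum_(j in P | j != i) (ab j).2 * cofac j) * u.
    by rewrite /b (bigD1 i) //=; ring.
  apply: gdvdB; first by case: bu (ceq_in Pi) => v -> [e ->]; exists (v * e); ring.
  apply: gdvd_mulr; apply: gdvd_sum => j /andP[Pj ji].
  by apply: gdvd_mull; apply: cofac_div; rewrite // eq_sym.
exists (tfrac_of (cls D a) hb) => i Pi; have iD := ceq_in Pi.
rewrite (restr_frac _ hb (nzd_restr iD hb) iD); have [hbi ->] := abP i.
apply/tfrac_cls_eq; rewrite /a /b mulr_suml mulr_suml -sumrB.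
apply: gdvd_sum => j Pj; have [->|ji] := eqVneq j i.
  by exists 0; ring.
have -> : (ab j).1 * cofac j * (ab i).2 - (ab j).2 * cofac j * (ab i).1
   = ((ab j).1 * (ab i).2 - (ab j).2 * (ab i).1) * cofac j by ring.
by apply: gdvd_mull; apply: cofac_div; rewrite // eq_sym.
Qed.

End Union.

End Curves.

Arguments branch_parts {F p} Di D rho i.
Arguments extend0 {F p} Di J D' rho i.
Arguments residues {F} D rho.

(* Main.v *)
Require Import Defs.
From mathcomp Require Import all_boot all_order all_algebra.
From mathcomp Require Import generic_quotient fraction.
From mathcomp Require Import boolp classical_sets reals complex.
From mathcomp Require Import ring.

(** Write [f = h f'] for the equations [f] of [D] and [f'] of [D'], so that [h]
    is an equation of the union of the branches outside [J].  The point is that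
    both inclusions are realised by one and the same form [w]: a residue of [D]
    vanishing on the branches of [h] comes from a form that has no pole there.
    Everything rests on [df/f = df'/f' + dh/h] and on two consequences of [D]
    being reduced: [f'] and [h] are non zero divisors modulo each other, and an
    element divisible by both is divisible by [f].

    From [D'] to [D].  A form [w] logarithmic along [D'] is logarithmic along
    [D].  A relation [g w = xi df'/f' + eta] gives, after multiplication by [h],
    [(h g) w = (h xi) df/f + holomorphic], but [h g] vanishes on the branches
    of [h].  As [f' w] is holomorphic it can be added freely, and the denominator
    [h g + f'] is a non zero divisor: modulo [f'] it is [h g], modulo [h] it is
    [f'].  The residue [h xi / (h g + f')] restricts to [xi / g] on the branches
    of [D'] and to [0] on the others ([is_residue_extension]).

    From [D] to [D'].  If [xi / g] vanishes on the branches outside [J], then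
    [h] divides [xi] ([gdvd_cofactor]), say [xi = c h].  The pole of [df/f]
    along [h] is then cancelled, [g w = xi df'/f' + (c dh + eta)], so [w] has the
    residue [xi / g] along [D'].  It is logarithmic along [D'] because the
    non zero divisor [g] can be cancelled in the divisibilities that express
    that [f' w] and [df' /\ w] are holomorphic ([is_residue_restriction]). *)

Set Implicit Arguments.
Unset Strict Implicit.
Unset Printing Implicit Defensive.

Import GRing.Theory.

Local Open Scope classical_set_scope.
Local Open Scope ring_scope.
Local Open Scope quotient_scope.

(** * Derivations and logarithmic derivatives in a fraction field *)

Lemma leibniz_quotient (K : fieldType) (a b c a' b' c' : K) : c != 0 ->
  ((a' * b + a * b') * c - a * b * c') / c ^+ 2 =
  a' * (b / c) + a * ((b' * c - b * c') / c ^+ 2).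
Proof. by move=> c0; field. Qed.

Lemma dlog_quotient (K : fieldType) (h f h' f' x : K) : h != 0 -> f != 0 ->
  x * ((h * f)^-1 * (h' * f + h * f')) = x * (f^-1 * f') + x * (h^-1 * h').
Proof. by move=> h0 f0; field; rewrite h0 f0. Qed.

Lemma cancel_products (K : fieldType) (p q x y : K) :
  x - y = (p + x) - (q + y) - (p - q).
Proof. by ring. Qed.

Section FractionField.
Variables (A : idomainType) (d : {additive A -> A}).
Hypothesis dM : forall a b, d (a * b) = d a * b + a * d b.
Local Notation "a %:F" := (@FracField.tofrac A a).

Lemma fracW (P : {fraction A} -> Prop) :
  (forall a b, b != 0 -> P (a%:F / b%:F)) -> forall m, P m.
Proof.
move=> H m; have r0 := denom_ratioP (repr m).
suff -> : m = (\n_(repr m))%:F / (\d_(repr m))%:F by exact: H.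
rewrite -[LHS]reprK; unlock FracField.tofrac.
rewrite -[_^-1]FracField.pi_inv -[RHS]FracField.pi_mul.
rewrite /FracField.mulf /FracField.invf.
rewrite !numden_Ratio ?oner_eq0 ?mul1r ?mulr1 //.
by apply/eqP; rewrite FracField.equivf_def !numden_Ratio // mulrC.
Qed.

Lemma frac_derZ a m :
  frac_der d (a%:F * m) = (d a)%:F * m + a%:F * frac_der d m.
Proof.
elim/fracW: m => b c c0; rewrite mulrA -[a%:F * b%:F]tofracM !frac_der_frac // dM.
rewrite tofracXn !tofracB !tofracM tofracD !tofracM.
by rewrite leibniz_quotient // tofrac_eq0.
Qed.

Lemma frac_der_tofrac a : frac_der d a%:F = (d a)%:F.
Proof.
have d1 : d 1 = 0.
  by apply: (addrI (d 1)); rewrite addr0 -[RHS](congr1 d (mulr1 1)) dM mulr1 mul1r.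
have := frac_der_frac dM a (oner_neq0 A).
by rewrite d1 expr1n mulr1 mulr0 subr0 tofrac1 !divr1.
Qed.

Lemma dlogM (h f x : A) : h != 0 -> f != 0 ->
  x%:F * ((h * f)%:F^-1 * (d (h * f))%:F) =
  x%:F * (f%:F^-1 * (d f)%:F) + x%:F * (h%:F^-1 * (d h)%:F).
Proof.
move=> h0 f0; rewrite dM tofracD !tofracM.
by rewrite dlog_quotient // tofrac_eq0.
Qed.

(** In the next three lemmas [m] stands for one of the two coefficients of a
    form, and [d] for the corresponding partial derivative.  This one adds the
    holomorphic [f m = a] to [h] times the relation for [f]; the summand
    [- x * d h] comes from replacing [df/f] by [d(hf)/(hf)]. *)
Lemma coef_extension (h f g x a e : A) (m : {fraction A}) :
  h != 0 -> f != 0 -> f%:F * m = a%:F ->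
  g%:F * m = x%:F * (f%:F^-1 * (d f)%:F) + e%:F ->
  (h * g + f)%:F * m =
    (h * x)%:F * ((h * f)%:F^-1 * (d (h * f))%:F) + (h * e - x * d h + a)%:F.
Proof.
move=> h0 f0 fm gm; rewrite dlogM // tofracD [in LHS]tofracM mulrDl fm -mulrA gm.
rewrite !tofracD tofracN !tofracM mulrDr !mulrA.
have -> : h%:F * x%:F / h%:F = x%:F by rewrite mulrC mulKf // tofrac_eq0.
rewrite -!addrA; congr (_ + _).
rewrite !addrA; congr (_ + _).
by rewrite [X in X - _]addrC addrK.
Qed.

(** The factor [h] of the numerator cancels the pole [dh/h]. *)
Lemma coef_restriction (h f g c e : A) (m : {fraction A}) :
  h != 0 -> f != 0 ->
  g%:F * m = (c * h)%:F * ((h * f)%:F^-1 * (d (h * f))%:F) + e%:F ->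
  g%:F * m = (c * h)%:F * (f%:F^-1 * (d f)%:F) + (c * d h + e)%:F.
Proof.
move=> h0 f0 ->; rewrite dlogM // tofracD -!addrA; congr (_ + _).
congr (_ + _); rewrite !tofracM mulrA.
by rewrite [c%:F * h%:F / _]mulfK // tofrac_eq0.
Qed.

(** A residue relation holds in the ring itself once the denominator [f] is
    cleared, which turns poles into divisibility by [f]. *)
Lemma clear_dlog (f g x e a : A) (m : {fraction A}) :
  f != 0 -> f%:F * m = a%:F ->
  g%:F * m = x%:F * (f%:F^-1 * (d f)%:F) + e%:F ->
  g * a = x * d f + f * e.
Proof.
move=> f0 fm gm; apply/eqP; rewrite -tofrac_eq tofracD !tofracM -fm mulrCA gm mulrDr.
by rewrite mulrCA mulVKf ?tofrac_eq0.
Qed.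

End FractionField.

(** * Logarithmic forms and residues of a curve and of a component *)

Section LogForms.
Variable F : numFieldType.
Local Notation A := (germ F).
Local Notation "a %:F" := (@FracField.tofrac A a).
Implicit Types (D E : curve F) (w : merform F) (a b g h u : A).

(** By Leibniz, [d(f w) = df /\ w + f dw]; so when [f w] is holomorphic, [f dw]
    is holomorphic as soon as [df /\ w] is.  The latter says that [f] divides
    [df /\ (f w)]. *)
Lemma log_form_criterion D w a b :
  (ceq D)%:F * w.1 = a%:F -> (ceq D)%:F * w.2 = b%:F ->
  gdvd (ceq D) (germ_dx (ceq D) * b - germ_dy (ceq D) * a) ->
  log_forms D w.
Proof.
set f := ceq D => fw1 fw2 [c cE]; split; first by split; [exists a | exists b].
have f0 : f%:F != 0 by rewrite tofrac_eq0 ceq_neq0.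
exists (germ_dx b - germ_dy a - c).
have dx := frac_derZ (@germ_dxM F) f w.2.
have dy := frac_derZ (@germ_dyM F) f w.1.
rewrite fw2 (frac_der_tofrac (@germ_dxM F)) in dx.
rewrite fw1 (frac_der_tofrac (@germ_dyM F)) in dy.
have cF : c%:F = (germ_dx f)%:F * w.2 - (germ_dy f)%:F * w.1.
  apply: (mulfI f0); rewrite mulrBr !(mulrCA f%:F) fw1 fw2 -!tofracM -tofracB cE.
  by rewrite mulrC.
by rewrite /ext_d mulrBr !tofracB cF dx dy; apply: cancel_products.
Qed.

Lemma log_formsS D D' : gdvd (ceq D') (ceq D) -> log_forms D' `<=` log_forms D.
Proof.
move=> [h fE] w [[[a aE] [b bE]] [c cE]].
have holZ (m : {fraction A}) u : (ceq D')%:F * m = u%:F ->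
    (ceq D)%:F * m = (h * u)%:F by move=> mE; rewrite fE !tofracM -mulrA mE.
split; last by exists (h * c); exact: holZ cE.
by split; [exists (h * a); exact: holZ aE | exists (h * b); exact: holZ bE].
Qed.

Section Component.
Variables (D D' : curve F) (h : A).
Hypothesis fE : ceq D = h * ceq D'.

Let h_neq0 : h != 0.
Proof. by apply: contraTneq (ceq_neq0 D) => h0; rewrite fE h0 mul0r eqxx. Qed.

(** If [h] divides [f' u], then [f = h f'] divides [(f' u)^2], hence [f' u]
    because [D] is reduced, and [f'] can be cancelled. *)
Lemma component_coprime u : gdvd h (ceq D' * u) -> gdvd h u.
Proof.
move=> [v vE]; have [|t tE] := @ceq_reduced _ D (ceq D' * u) 2.
  by exists (v * u); rewrite expr2 {1}vE fE; ring.
by exists t; apply: (mulfI (ceq_neq0 D')); rewrite tE fE; ring.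
Qed.

Lemma cofactor_coprime u : gdvd (ceq D') (h * u) -> gdvd (ceq D') u.
Proof.
move=> [v vE]; have [|t tE] := @ceq_reduced _ D (h * u) 2.
  by exists (v * u); rewrite expr2 {1}vE fE; ring.
by exists t; apply: (mulfI h_neq0); rewrite tE fE; ring.
Qed.

Lemma gdvd_reduced u : gdvd h u -> gdvd (ceq D') u -> gdvd (ceq D) u.
Proof.
move=> [v vE] [t tE]; apply: (@ceq_reduced _ D u 2).
by exists (v * t); rewrite expr2 {1}vE tE fE; ring.
Qed.

(** The denominator is checked separately modulo [h], where it is [f'], and
    modulo [f'], where it is [h g]. *)
Lemma nzd_extension g : nzd (cls D' g) -> nzd (cls D (h * g + ceq D')).
Proof.
move=> /nzd_cls ng; apply/nzd_cls => u [v vE]; apply: gdvd_reduced.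
  apply: component_coprime.
  exists (v * ceq D' - g * u); transitivity ((h * g + ceq D') * u - h * g * u).
    by ring.
  by rewrite vE fE; ring.
apply/ng/cofactor_coprime.
exists (v * h - u); transitivity ((h * g + ceq D') * u - u * ceq D'); first by ring.
by rewrite vE fE; ring.
Qed.

(** When the residue along [D'] is [x / g], the one along [D] is
    [h x / (h g + f')].  Modulo [f'] the factor [h] cancels, and modulo [h] the
    numerator vanishes. *)
Lemma is_residue_extension w (rho' : frac_ring D') :
  log_forms D' w -> is_residue w rho' ->
  exists rho : frac_ring D, [/\ is_residue w rho,
    forall E, gdvd (ceq E) (ceq D') -> restr E rho = restr E rho'
    & forall E, gdvd (ceq E) h -> restr E rho = 0].
Proof.
move=> [[[a aE] [b bE]] _] [g [x [hg [eta [[[e1 e1E] [e2 e2E]] wE ->]]]]].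
have hG := nzd_extension hg.
have f0 := ceq_neq0 D'.
exists (tfrac_of (cls D (h * x)) hG); split.
- have w1 := congr1 fst wE; have w2 := congr1 snd wE.
  rewrite /= e1E in w1; rewrite /= e2E in w2.
  have W1 := coef_extension (@germ_dxM F) h_neq0 f0 aE w1.
  have W2 := coef_extension (@germ_dyM F) h_neq0 f0 bE w2.
  exists (h * g + ceq D'), (h * x), hG.
  exists ((h * e1 - x * germ_dx h + a)%:F, (h * e2 - x * germ_dy h + b)%:F).
  split=> //; first by split; eexists.
  by rewrite fE; apply/pair_equal_spec; split; [exact: W1 | exact: W2].
- move=> E ED'; have ED : gdvd (ceq E) (ceq D) by rewrite fE; apply: gdvd_mull.
  rewrite (restr_frac _ _ (nzd_restr ED hG) ED).
  rewrite (restr_frac _ _ (nzd_restr ED' hg) ED').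
  apply/tfrac_cls_eq; have -> : h * x * g - (h * g + ceq D') * x = (- x) * ceq D'.
    by ring.
  exact: gdvd_mull.
- move=> E Eh; have ED : gdvd (ceq E) (ceq D) by rewrite fE; apply: gdvd_mulr.
  rewrite (restr_frac _ _ (nzd_restr ED hG) ED).
  apply/tfrac_eq; rewrite mulr1 mulr0 -(cls0 E).
  by apply/cls_eq; rewrite subr0; apply: gdvd_mulr.
Qed.

(** A relation whose numerator is divisible by [h] removes the pole of [w]
    along [h].  Being a non zero divisor modulo [f], [g] is cancelled first in
    [h | g (f w)], which gives that [f' w] is holomorphic, then in
    [f' | g (df' /\ f' w)]. *)
Lemma is_residue_restriction w g c (eta : merform F)
    (hg : nzd (cls D g)) (hg' : nzd (cls D' g)) :
  log_forms D w -> holomorphic_form eta ->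
  g%:F *: w = (c * h)%:F *: ((ceq D)%:F^-1 *: dfun (ceq D)) + eta ->
  log_forms D' w /\ is_residue w (tfrac_of (cls D' (c * h)) hg').
Proof.
move=> [[[a aE] [b bE]] _] [[e1 e1E] [e2 e2E]] wE.
have f0 := ceq_neq0 D'.
have w1 := congr1 fst wE; have w2 := congr1 snd wE.
rewrite /= e1E in w1; rewrite /= e2E in w2.
(* The same argument serves both coefficients of [w]. *)
have pole (d : {additive A -> A}) m n e :
    (forall u v, d (u * v) = d u * v + u * d v) ->
    (ceq D)%:F * m = n%:F ->
    g%:F * m = (c * h)%:F * ((ceq D)%:F^-1 * (d (ceq D))%:F) + e%:F ->
    exists n', (ceq D')%:F * m = n'%:F.
  move=> dM nE mE; have := clear_dlog (ceq_neq0 D) nE mE.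
  rewrite fE dM => gn.
  have [|t tE] := component_coprime (u := n).
    (* f divides g * (f' * n), so h * f' divides f' * n. *)
    have /nzd_cls ng := hg; have [|t tE] := ng (ceq D' * n).
      exists (c * (d h * ceq D' + h * d (ceq D')) + ceq D' * e).
      by rewrite mulrCA gn fE; ring.
    by exists (t * ceq D'); rewrite tE fE; ring.
  exists t; apply: (@mulfI _ h%:F); first by rewrite tofrac_eq0.
  by rewrite mulrA -tofracM -fE nE tE tofracM mulrC.
have [a' a'E] := pole _ _ _ _ (@germ_dxM F) aE w1.
have [b' b'E] := pole _ _ _ _ (@germ_dyM F) bE w2.
move: w1 w2; rewrite fE.
move=> /(coef_restriction (@germ_dxM F) h_neq0 f0) w1.
move=> /(coef_restriction (@germ_dyM F) h_neq0 f0) w2.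
split; last first.
  exists g, (c * h), hg', ((c * germ_dx h + e1)%:F, (c * germ_dy h + e2)%:F).
  split=> //; first by split; eexists.
  by apply/pair_equal_spec; split; [exact: w1 | exact: w2].
apply: (log_form_criterion a'E b'E).
have /nzd_cls := hg'; apply.
have ga := clear_dlog f0 a'E w1; have gb := clear_dlog f0 b'E w2.
exists (germ_dx (ceq D') * (c * germ_dy h + e2)
        - germ_dy (ceq D') * (c * germ_dx h + e1)).
rewrite mulrBr !(mulrCA g) ga gb; ring.
Qed.

End Component.

(** * Curves with given branches *)

Section Branches.
Variables (I : finType) (Di : I -> curve F) (J : {set I}) (D D' : curve F).
Hypotheses (DU : is_union predT Di D) (D'U : is_union J Di D').

Lemma is_union_gdvd (P : {pred I}) E i :
  is_union P Di E -> i \in P -> gdvd (ceq (Di i)) (ceq E).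
Proof.
move=> [u _ ->] Pi; rewrite (bigD1 i) //=; apply: gdvd_mull.
by apply: gdvd_mulr; exists 1; rewrite mul1r.
Qed.

Lemma is_union_component : exists2 h, ceq D = h * ceq D' &
  forall i, i \notin J -> gdvd (ceq (Di i)) h.
Proof.
case: DU => u _ ->; case: D'U => v vU ->.
exists (u * v^-1 * \prod_(i | i \notin J) ceq (Di i)) => [|i iJ].
  rewrite (bigID (mem J)) /= -{1}[u](mulrVK vU); ring.
rewrite (bigD1 i) //=; apply/gdvd_mull/gdvd_mulr.
by exists 1; rewrite mul1r.
Qed.

(** On the branches in [J] the factor [f'] vanishes, on the others [x] does; so
    [f' x / g] is zero on every branch, hence zero, and [f = h f'] divides
    [f' x]. *)
Lemma gdvd_cofactor h x g (hg : nzd (cls D g)) : ceq D = h * ceq D' ->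
  (forall i, i \notin J -> restr (Di i) (tfrac_of (cls D x) hg) = 0) ->
  gdvd h x.
Proof.
move=> fE x0.
have : tfrac_of (cls D (ceq D' * x)) hg = tfrac_of (cls D 0) hg.
  apply: (restr_inj DU) => i _; have iD := is_union_gdvd DU (isT : i \in predT).
  rewrite !(restr_frac _ hg (nzd_restr iD hg) iD); apply/tfrac_eq.
  rewrite cls0 mulr0 -clsM -(cls0 (Di i)); apply/cls_eq; rewrite subr0.
  apply: gdvd_mulr; have [iJ|/x0] := boolP (i \in J).
    by apply: gdvd_mulr; apply: is_union_gdvd D'U iJ.
  rewrite (restr_frac _ hg (nzd_restr iD hg) iD) => /tfrac_eq.
  rewrite mulr1 mulr0 -(cls0 (Di i)) => /cls_eq; rewrite subr0.
  exact: gdvd_mull.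
move=> /tfrac_cls_eq; rewrite mulr0 subr0 mulrC; have /nzd_cls ng := hg.
move=> /ng [t tE]; exists t; apply: (mulfI (ceq_neq0 D')).
by rewrite tE fE; ring.
Qed.

End Branches.
End LogForms.

Theorem proposition3p15 (R : realType) (p : nat)
    (D : curve R[i]) (Di : 'I_p -> curve R[i])
    (J : {set 'I_p}) (D' : curve R[i]) :
  (forall i, irreducible_curve (Di i)) ->
  is_union predT Di D ->
  J != finset.set0 ->
  is_union J Di D' ->
  log_forms D' `<=` log_forms D /\
  (branch_parts Di D @` residues D)
    `&` [set z | forall i, i \notin J -> z i = 0]
  = extend0 Di J D' @` residues D'.
Proof.
move=> _ DU _ D'U; have [h fE hJ] := is_union_component DU D'U.
have D'D : gdvd (ceq D') (ceq D) by exists h.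
split; first exact: log_formsS.
apply/seteqP; split => z /=.
- move=> [[_ [w wD [g [x [hg [eta [etaH wE ->]]]]]] <-] z0].
  have [c cE] := gdvd_cofactor DU D'U fE z0.
  rewrite cE in wE; have hg' := nzd_restr D'D hg.
  have [wD' wres] := is_residue_restriction fE hg hg' wD etaH wE.
  exists (tfrac_of (cls D' (c * h)) hg'); first by exists w.
  apply: functional_extensionality_dep => i; rewrite /extend0.
  case: ifPn => [iJ|/z0 -> //]; rewrite /branch_parts cE.
  have iD' := is_union_gdvd D'U iJ.
  have iD := is_union_gdvd DU (isT : i \in predT).
  have hgi := nzd_restr iD hg.
  by rewrite (restr_frac _ _ hgi iD) (restr_frac _ _ hgi iD').
- move=> [rho' [w wD' wres'] <-].
  have [rho [wres rhoJ rho0]] := is_residue_extension fE wD' wres'.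
  split; last by move=> i /negbTE iJ; rewrite /extend0 iJ.
  exists rho; first by exists w => //; apply: log_formsS wD'.
  apply: functional_extensionality_dep => i; rewrite /extend0 /branch_parts.
  case: ifPn => [iJ|iJ]; first exact/rhoJ/(is_union_gdvd D'U iJ).
  exact/rho0/hJ.
Qed.
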